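(* Let $A=(a_{ij})$ be an $m\times n$ matrix with all entries positive and with columns $a_1,\dots,a_n$, and let $\Delta=\mathbf{1}^{T}AA^{-}\mathbf{1}$ (max-algebraic product). For indices $l\in\{1,\dots,m\}$ and $k\in\{1,\dots,n\}$, let $A_{lk}$ be the $m\times n$ matrix obtained from $A$ by keeping the entry $a_{lk}$ and replacing all other entries by zero. Consider the problem of maximizing $$\mathbf{1}^{T}Ax(Ax)^{-}\mathbf{1}$$ over all vectors $x\in\mathbb{R}_+^n$ with all entries positive. Then the optimal (maximum) value of this problem equals $\Delta$. Moreover, a positive vector $x$ is a solution (i.e. attains the maximum) if and only if there exist indices $k$ and $l$ with $$\mathbf{1}^{T}a_{k}\,a_{lk}^{-1}=\Delta$$ and a vector $u\in\mathbb{R}_+^n$ with all entries positive such that $$x=(I\oplus A_{lk}^{-}A)u .$$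
   Context: All operations are in the max-algebra (tropical algebra) on the nonnegative reals $\mathbb{R}_+=[0,\infty)$: addition is $a\oplus b=\max(a,b)$ and multiplication is ordinary multiplication. Matrix and vector operations are defined by the usual rules with $+$ replaced by $\oplus$, e.g. $(Ax)_i=\max_j a_{ij}x_j$ and $(A\oplus B)_{ij}=\max(a_{ij},b_{ij})$. $I$ is the usual identity matrix, and $\mathbf{1}$ denotes the column vector, of the appropriate size, with all entries equal to $1$. The conjugate transpose of a nonzero $m\times n$ matrix $A=(a_{ij})$ is the $n\times m$ matrix $A^{-}=(a^{-}_{ij})$ with $a^{-}_{ij}=a_{ji}^{-1}$ if $a_{ji}\neq 0$ and $a^{-}_{ij}=0$ otherwise; for a nonzero column vector $y$, $y^{-}$ is the row vector with entries $y_i^{-1}$ if $y_i\ne 0$ and $0$ otherwise. $A_{lk}^{-}$ means the conjugate transpose $(A_{lk})^{-}$, so its only nonzero entry is $a_{lk}^{-1}$, in position $(k,l)$. Thus, for positive $x$ and $y=Ax$, the objective is $\mathbf{1}^{T}yy^{-}\mathbf{1}=(\max_i y_i)(\max_j 1/y_j)$, the exponential of the Hilbert seminorm of $y$. Also $\mathbf{1}^{T}a_k=\max_i a_{ik}$ and $\Delta=\max_{k}\big(\max_i a_{ik}\big)\big(\max_l a_{lk}^{-1}\big)$. *)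

(* Defs.v *)
(* MathComp; the reals are an arbitrary R : realType. *)
From HB Require Import structures.
From mathcomp Require Import all_boot all_order all_algebra.
From mathcomp Require Import reals.

Set Implicit Arguments.
Unset Strict Implicit.
Unset Printing Implicit Defensive.

Import Order.TTheory GRing.Theory Num.Theory.
Local Open Scope ring_scope.

(* The max-algebra: the nonnegative reals with maximum as addition and the
   ordinary multiplication.  With the commutative semiring structure below, the
   library's *m, +, 1%:M and \sum on matrices over [maxalg R] are the
   max-algebraic ones; the order is that of R. *)
Record maxalg (R : realType) := MaxAlg {
  maxval : R;
  maxval_nneg : 0 <= maxval
}.

Section MaxAlgebra.
Variable R : realType.
Local Notation T := (maxalg R).
Implicit Types x y z : T.

HB.instance Definition _ := [isSub for @maxval R].
HB.instance Definition _ := [Choice of T by <:].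
HB.instance Definition _ := [SubChoice_isSubOrder of T by <: with ring_display].

Fact maxalg_add_nneg x y : 0 <= Num.max (val x) (val y).
Proof. by rewrite le_max (valP x). Qed.

Fact maxalg_mul_nneg x y : 0 <= val x * val y.
Proof. exact: mulr_ge0 (valP x) (valP y). Qed.

Fact maxalg_inv_nneg x : 0 <= (val x)^-1.
Proof. by rewrite invr_ge0 (valP x). Qed.

Definition maxalg_zero : T := MaxAlg (lexx 0).
Definition maxalg_one : T := MaxAlg ler01.
Definition maxalg_add x y : T := MaxAlg (maxalg_add_nneg x y).
Definition maxalg_mul x y : T := MaxAlg (maxalg_mul_nneg x y).

(* Only meaningful for x != 0; as in R, the inverse of 0 is 0. *)
Definition maxinv x : T := MaxAlg (maxalg_inv_nneg x).

Fact maxalg_addA : associative maxalg_add.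
Proof. by move=> x y z; apply: val_inj; rewrite /= maxA. Qed.

Fact maxalg_addC : commutative maxalg_add.
Proof. by move=> x y; apply: val_inj; rewrite /= maxC. Qed.

Fact maxalg_add0 : left_id maxalg_zero maxalg_add.
Proof. by move=> x; apply: val_inj; rewrite /= max_r ?(valP x). Qed.

Fact maxalg_mulA : associative maxalg_mul.
Proof. by move=> x y z; apply: val_inj; rewrite /= mulrA. Qed.

Fact maxalg_mulC : commutative maxalg_mul.
Proof. by move=> x y; apply: val_inj; rewrite /= mulrC. Qed.

Fact maxalg_mul1 : left_id maxalg_one maxalg_mul.
Proof. by move=> x; apply: val_inj; rewrite /= mul1r. Qed.

Fact maxalg_mulDl : left_distributive maxalg_mul maxalg_add.
Proof. by move=> x y z; apply: val_inj; rewrite /= maxr_pMl ?(valP z). Qed.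

Fact maxalg_mul0 : left_zero maxalg_zero maxalg_mul.
Proof. by move=> x; apply: val_inj; rewrite /= mul0r. Qed.

Fact maxalg_one_neq0 : maxalg_one != maxalg_zero.
Proof. by rewrite -val_eqE /= oner_eq0. Qed.

HB.instance Definition _ :=
  GRing.isNmodule.Build T maxalg_addA maxalg_addC maxalg_add0.
HB.instance Definition _ :=
  GRing.Nmodule_isComNzSemiRing.Build T maxalg_mulA maxalg_mulC maxalg_mul1
    maxalg_mulDl maxalg_mul0 maxalg_one_neq0.

Lemma val_maxalg0 : val (0 : T) = 0 :> R. Proof. by []. Qed.
Lemma val_maxalg1 : val (1 : T) = 1 :> R. Proof. by []. Qed.

Lemma val_maxalgD x y : val (x + y) = Num.max (val x) (val y).
Proof. by []. Qed.

Lemma val_maxalgM x y : val (x * y) = val x * val y.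
Proof. by []. Qed.

Lemma le_maxalgE x y : (x <= y) = (val x <= val y).
Proof. by []. Qed.

Lemma lt_maxalgE x y : (x < y) = (val x < val y).
Proof. by []. Qed.

End MaxAlgebra.

Section Matrices.
Variables (R : realType) (m n : nat).
Local Notation T := (maxalg R).

(* The conjugate transpose A^-. *)
Definition conjtr (A : 'M[T]_(m, n)) : 'M[T]_(n, m) :=
  \matrix_(i, j) (if A j i != 0 then maxinv (A j i) else 0).

Definition positive_mx (A : 'M[T]_(m, n)) : Prop := forall i j, (0 : T) < A i j.

(* The matrix A_lk keeping only the entry of A in row l and column k. *)
Definition keep_entry (A : 'M[T]_(m, n)) (l : 'I_m) (k : 'I_n) : 'M[T]_(m, n) :=
  \matrix_(i, j) (if (i == l) && (j == k) then A i j else 0).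

End Matrices.

(* The scalar 1^T B 1; 1^T and 1 are the all-ones row and column. *)
Definition ones_form (R : realType) (m : nat) (B : 'M[maxalg R]_m) : maxalg R :=
  ((const_mx 1 : 'rV_m) *m B *m (const_mx 1 : 'cV_m)) ord0 ord0.

Definition objective (R : realType) (m n : nat) (A : 'M[maxalg R]_(m, n))
    (x : 'cV[maxalg R]_n) : maxalg R :=
  ones_form ((A *m x) *m conjtr (A *m x)).

Definition is_solution (R : realType) (m n : nat) (A : 'M[maxalg R]_(m, n))
    (x : 'cV[maxalg R]_n) : Prop :=
  positive_mx x /\
  forall z : 'cV[maxalg R]_n, positive_mx z -> objective A z <= objective A x.

(* v is the maximum of the objective over positive vectors, not merely its
   supremum. *)
Definition is_optimal_value (R : realType) (m n : nat)
    (A : 'M[maxalg R]_(m, n)) (v : maxalg R) : Prop :=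
  exists2 x : 'cV[maxalg R]_n, is_solution A x & objective A x = v.

(* Main.v *)
(** Every entry of [y = A x] is some term [a_ik x_k], while [a_lk x_k <= y_l];
    so [y_i / y_l <= a_ik / a_lk <= Delta], with equality only if
    [y_l = a_lk x_k].  The latter condition says that [x] is a fixed point of
    [I + A_lk^- A], which is an idempotent matrix, and hence that [x] lies in
    its image. *)
Require Import Defs.
From mathcomp Require Import all_boot all_order all_algebra.
From mathcomp Require Import reals.
Import Order.TTheory GRing.Theory Num.Theory.
Local Open Scope ring_scope.

Section MaxAlgebraTheory.
Set Implicit Arguments.
Unset Strict Implicit.
Variable R : realType.
Local Notation T := (maxalg R).
Implicit Types x y z : T.

(** * Order and arithmetic of scalars in the max-algebra *)

Lemma maxalg_ge0 x : (0 : T) <= x.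
Proof. exact: (valP x). Qed.

Lemma maxalg_addE x y : x + y = if x <= y then y else x.
Proof.
by apply: val_inj; rewrite val_maxalgD le_maxalgE; case: leP.
Qed.

Lemma maxalg_add_idPr x y : reflect (x + y = y) (x <= y).
Proof.
apply: (iffP idP) => [le_xy|<-]; first by rewrite maxalg_addE le_xy.
by rewrite le_maxalgE val_maxalgD le_max lexx.
Qed.

Lemma maxalg_addxx x : x + x = x.
Proof. by apply/maxalg_add_idPr; rewrite lexx. Qed.

Lemma maxalg_lt0D x y : (0 : T) < x -> (0 : T) < x + y.
Proof. by rewrite !lt_maxalgE val_maxalgD lt_max => ->. Qed.

Lemma maxalg_mulV x : (0 : T) < x -> maxinv x * x = 1.
Proof.
by rewrite lt_maxalgE => x_gt0; apply: val_inj; rewrite /= mulVf ?gt_eqF.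
Qed.

Lemma maxinv0 : maxinv (0 : T) = 0.
Proof. by apply: val_inj; rewrite /= invr0. Qed.

Lemma maxalg_lt0M x y : (0 : T) < x -> (0 : T) < y -> (0 : T) < x * y.
Proof. by rewrite !lt_maxalgE val_maxalgM; exact: mulr_gt0. Qed.

Lemma maxalg_leM x y z t : x <= y -> z <= t -> x * z <= y * t.
Proof.
by rewrite !le_maxalgE !val_maxalgM => xy zt; rewrite ler_pM ?(valP x) ?(valP z).
Qed.

Lemma maxalg_le_div x y z t :
  (0 : T) < y -> (0 : T) < t ->
  (x * maxinv y <= z * maxinv t) = (x * t <= z * y).
Proof.
rewrite !lt_maxalgE !le_maxalgE => y0 t0.
by rewrite !val_maxalgM /= ler_pdivrMr // mulrAC ler_pdivlMr.
Qed.

Lemma maxalg_ler_sum (I : finType) (F : I -> T) i : F i <= \sum_j F j.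
Proof.
by apply/maxalg_add_idPr; rewrite (bigD1 i) //= addrA maxalg_addxx.
Qed.

(* The index [i0] only witnesses that the sum is not empty. *)
Lemma maxalg_sum_attained (I : finType) (i0 : I) (F : I -> T) :
  exists i, \sum_j F j = F i.
Proof.
(* Induction must admit the value 0 of an empty sum. In that case the term at [i0] lies between 0
   and the sum, so it equals the sum. *)
have: \sum_j F j = 0 \/ exists i, \sum_j F j = F i.
  elim/big_ind: _ => [|x y hx hy|i _]; [by left| |by right; exists i].
  by rewrite maxalg_addE; case: ifP.
case=> // sum0; exists i0; apply: le_anti.
by rewrite maxalg_ler_sum sum0 maxalg_ge0.
Qed.

(** * Quotients of entries and the image of [1%:M + conjtr (keep_entry A l k) *m A] *)

Section Matrices.
Variables m n : nat.

Lemma ones_formE (B : 'M[T]_m) : ones_form B = \sum_j \sum_i B i j.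
Proof.
rewrite /ones_form mxE; apply: eq_bigr => j _.
by rewrite !mxE mulr1; apply: eq_bigr => i _; rewrite mxE mul1r.
Qed.

Lemma ones_row_colE (A : 'M[T]_(m, n)) k :
  ((const_mx 1 : 'rV_m) *m col k A) ord0 ord0 = \sum_i A i k.
Proof. by rewrite mxE; apply: eq_bigr => i _; rewrite !mxE mul1r. Qed.

(** The case split in [conjtr] disappears because [maxinv] sends 0 to 0. *)
Lemma conjtrE (A : 'M[T]_(m, n)) k l : conjtr A k l = maxinv (A l k).
Proof. by rewrite mxE; case: eqP => //= ->; rewrite maxinv0. Qed.

(** Together with the next lemma, this makes the form the largest quotient of two entries in a
    common column. Both are applied to [A] and to the single column [A *m x]. *)
Lemma ones_form_conjtr_ge (A : 'M[T]_(m, n)) i k l :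
  A i k * maxinv (A l k) <= ones_form (A *m conjtr A).
Proof.
pose AA := A *m conjtr A; rewrite ones_formE -/AA.
apply: le_trans (maxalg_ler_sum (fun l => \sum_i AA i l) l).
apply: le_trans (maxalg_ler_sum (fun i => AA i l) i).
by rewrite mxE -conjtrE; exact: (maxalg_ler_sum (fun k => A i k * conjtr A k l)).
Qed.

Lemma ones_form_conjtr_attained (A : 'M[T]_(m, n)) :
  (0 < m)%N -> (0 < n)%N ->
  exists i k l, ones_form (A *m conjtr A) = A i k * maxinv (A l k).
Proof.
move=> hm hn; rewrite ones_formE.
have [l ->] := maxalg_sum_attained (Ordinal hm)
  (fun l => \sum_i (A *m conjtr A) i l).
have [i ->] := maxalg_sum_attained (Ordinal hm) (fun i => (A *m conjtr A) i l).
rewrite mxE.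
have [k ->] := maxalg_sum_attained (Ordinal hn) (fun k => A i k * conjtr A k l).
by exists i, k, l; rewrite conjtrE.
Qed.

Lemma mulmx_ge_term (A : 'M[T]_(m, n)) (x : 'cV[T]_n) i k :
  A i k * x k ord0 <= (A *m x) i ord0.
Proof. by rewrite mxE; exact: (maxalg_ler_sum (fun k => A i k * x k ord0)). Qed.

Lemma mulmx_attained (A : 'M[T]_(m, n)) (x : 'cV[T]_n) i :
  (0 < n)%N -> exists k, (A *m x) i ord0 = A i k * x k ord0.
Proof.
move=> hn; rewrite mxE.
exact: (maxalg_sum_attained (Ordinal hn) (fun k => A i k * x k ord0)).
Qed.

Lemma positive_mulmx (A : 'M[T]_(m, n)) (x : 'cV[T]_n) :
  (0 < n)%N -> positive_mx A -> positive_mx x -> positive_mx (A *m x).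
Proof.
move=> hn hA hx i j; rewrite ord1.
by have [k ->] := mulmx_attained A x i hn; exact: maxalg_lt0M.
Qed.

Lemma mul_conjtr_keep_entry (A : 'M[T]_(m, n)) l k (w : 'cV[T]_m) j :
  (conjtr (keep_entry A l k) *m w) j ord0 =
  if j == k then maxinv (A l k) * w l ord0 else 0.
Proof.
rewrite mxE (bigD1 l) //= conjtrE mxE eqxx /= big1 => [|i /negPf il].
  by rewrite addr0; case: eqP => [->//|_]; rewrite maxinv0 mul0r.
by rewrite conjtrE mxE il maxinv0 mul0r.
Qed.

(** The matrix raises [u_k] to [(A u)_l / a_lk] and keeps the other entries of [u]. Row [l] of the
    product with [A] stays at [(A u)_l], which is now attained at index [k]. *)
Lemma image_keep_entryP (A : 'M[T]_(m, n)) l k (x : 'cV[T]_n) :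
  positive_mx A -> positive_mx x ->
  (exists2 u : 'cV[T]_n, positive_mx u &
     x = (1%:M + conjtr (keep_entry A l k) *m A) *m u) <->
  (A *m x) l ord0 = A l k * x k ord0.
Proof.
move=> hA hx; have Alk := maxalg_mulV (hA l k).
have Alk' w : A l k * (maxinv (A l k) * w) = w by rewrite mulrCA mulrA Alk mul1r.
split=> [[u _ ->]|eq_l].
  rewrite mulmxDl mul1mx -mulmxA mulmxDr !mxE.
  have -> : \sum_j A l j * (conjtr (keep_entry A l k) *m (A *m u)) j ord0 =
            (A *m u) l ord0.
    rewrite (bigD1 k) //= mul_conjtr_keep_entry eqxx Alk' big1 ?addr0 //.
    by move=> j /negPf jk; rewrite mul_conjtr_keep_entry jk mulr0.
  have := mul_conjtr_keep_entry A l k (A *m u) k; rewrite eqxx mxE => ->.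
  rewrite mulrDr Alk'.
  have /maxalg_add_idPr -> := mulmx_ge_term A u l k.
  by rewrite !mxE maxalg_addxx.
(* Here [x_k] already equals [(A x)_l / a_lk], so [x] is its own preimage. *)
exists x => //; apply/matrixP => j o; rewrite ord1 mulmxDl mul1mx -mulmxA.
rewrite [RHS]mxE mul_conjtr_keep_entry; case: eqP => [->|_]; last by rewrite addr0.
by rewrite eq_l mulrA Alk mul1r maxalg_addxx.
Qed.

(** The column maximum is attained in some row, and no quotient exceeds the form; this trades the
    maximum for a single entry [A i k]. *)
Lemma ones_row_col_div_eqP (A : 'M[T]_(m, n)) k l :
  (0 < m)%N ->
  ((const_mx 1 : 'rV[T]_m) *m col k A) ord0 ord0 * maxinv (A l k) =
    ones_form (A *m conjtr A) <->
  exists i, A i k * maxinv (A l k) = ones_form (A *m conjtr A).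
Proof.
move=> hm; rewrite ones_row_colE.
have [i0 sum_i0] := maxalg_sum_attained (Ordinal hm) (fun i => A i k).
split=> [<-|[i eqD]]; first by exists i0; rewrite sum_i0.
apply: le_anti; rewrite {1}sum_i0 ones_form_conjtr_ge /= -eqD.
apply: maxalg_leM; first exact: (maxalg_ler_sum (fun i => A i k)).
exact: lexx.
Qed.

End Matrices.

(** * The objective compared with [Delta] *)

Section Objective.
Variables (m n : nat) (A : 'M[T]_(m, n)) (x : 'cV[T]_n).
Hypotheses (hm : (0 < m)%N) (hn : (0 < n)%N).
Hypotheses (hA : positive_mx A) (hx : positive_mx x).
Let Delta := ones_form (A *m conjtr A).

(** The index [k] is one that attains row [i] of [A *m x]; the bound and its equality case must
    share it. *)
Lemma objective_term_le i l : exists k,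
  (A *m x) i ord0 * maxinv ((A *m x) l ord0) <= A i k * maxinv (A l k) /\
  ((A *m x) i ord0 * maxinv ((A *m x) l ord0) = A i k * maxinv (A l k) ->
   (A *m x) l ord0 = A l k * x k ord0).
Proof.
have [k eq_i] := mulmx_attained A x i hn; exists k.
have y0 := positive_mulmx hn hA hx l ord0.
have le_l := mulmx_ge_term A x l k.
rewrite eq_i; split.
  by rewrite maxalg_le_div // -mulrA maxalg_leM // mulrC.
move=> eq_div; apply: le_anti; rewrite le_l andbT.
(* Rewriting the right-hand copy by [eq_div] and cross-multiplying gives [a_ik y_l <= a_ik x_k a_lk]
   with [y = A x]; the positive factor [a_ik] then cancels. *)
have := lexx (A i k * maxinv (A l k)).
rewrite -{2}eq_div maxalg_le_div // -mulrA.
rewrite !le_maxalgE !val_maxalgM ler_pM2l ?(mulrC (val (x k _))) //.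
exact: hA.
Qed.

Lemma objective_le : objective A x <= Delta.
Proof.
have [i [o [l]]] := ones_form_conjtr_attained (A *m x) hm (ltn0Sn 0).
rewrite ord1 /objective => ->.
have [k [le_k _]] := objective_term_le i l.
exact: le_trans le_k (ones_form_conjtr_ge A i k l).
Qed.

Lemma objective_eqP :
  objective A x = Delta <->
  exists (k : 'I_n) (l : 'I_m),
    ((const_mx 1 : 'rV[T]_m) *m col k A) ord0 ord0 * maxinv (A l k) = Delta /\
    exists2 u : 'cV[T]_n, positive_mx u &
      x = (1%:M + conjtr (keep_entry A l k) *m A) *m u.
Proof.
split=> [eqD|[k [l [/ones_row_col_div_eqP-/(_ hm) [i eqD]]]]].
  have [i [o [l]]] := ones_form_conjtr_attained (A *m x) hm (ltn0Sn 0).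
  rewrite ord1 -/(objective A x) eqD => eq_il.
  have [k [le_k eq_k]] := objective_term_le i l.
  (* The quotient [a_ik / a_lk] is squeezed between [y_i / y_l = Delta] and [Delta], which also
     triggers the equality case [eq_k]. *)
  have eq_ilk : A i k * maxinv (A l k) = Delta.
    by apply: le_anti; rewrite ones_form_conjtr_ge /= eq_il.
  exists k, l; split; first by apply/ones_row_col_div_eqP => //; exists i.
  by apply/image_keep_entryP => //; apply: eq_k; rewrite -eq_il.
move=> /image_keep_entryP-/(_ hA hx) eq_l.
apply: le_anti; rewrite objective_le /= /Delta -eqD.
(* Since [y_l = a_lk x_k] and [y_i >= a_ik x_k], the quotient [y_i / y_l] is at least
   [a_ik / a_lk = Delta]. *)
apply: le_trans (ones_form_conjtr_ge (A *m x) i ord0 l).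
rewrite maxalg_le_div ?positive_mulmx // eq_l mulrCA [leRHS]mulrC.
by rewrite maxalg_leM ?mulmx_ge_term.
Qed.

End Objective.

End MaxAlgebraTheory.

Theorem corollary4p2 (R : realType) (m n : nat) (hm : (0 < m)%N) (hn : (0 < n)%N)
    (A : 'M[maxalg R]_(m, n)) (hA : positive_mx A) :
  let Delta : maxalg R := ones_form (A *m conjtr A) in
  is_optimal_value A Delta /\
  (forall x : 'cV[maxalg R]_n, positive_mx x ->
     (is_solution A x <->
      exists (k : 'I_n) (l : 'I_m),
        ((const_mx 1 : 'rV[maxalg R]_m) *m col k A) ord0 ord0 * maxinv (A l k)
          = Delta /\
        exists2 u : 'cV[maxalg R]_n, positive_mx u &
          x = (1%:M + conjtr (keep_entry A l k) *m A) *m u)).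
Proof.
move=> Delta.
have solution_of x : positive_mx x -> objective A x = Delta -> is_solution A x.
  by move=> hx eqD; split=> // z hz; rewrite eqD; exact: objective_le.
have [x0 hx0 eqD0] : exists2 x, positive_mx x & objective A x = Delta.
  have [i [k [l eqD]]] := ones_form_conjtr_attained A hm hn.
  (* Any positive [u] would give a maximizer; its image is positive because the identity summand
     keeps it above [u]. *)
  pose u : 'cV[maxalg R]_n := const_mx 1.
  have hu : positive_mx u by move=> a b; rewrite mxE lt_maxalgE ltr01.
  have hx : positive_mx ((1%:M + conjtr (keep_entry A l k) *m A) *m u).
    by move=> a b; rewrite mulmxDl mul1mx mxE; exact/maxalg_lt0D/hu.
  exists ((1%:M + conjtr (keep_entry A l k) *m A) *m u) => //.
  apply/objective_eqP => //; exists k, l; split; last by exists u.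
  by apply/ones_row_col_div_eqP => //; exists i.
split; first by exists x0 => //; exact: solution_of.
move=> x hx; split=> [[_ sol_x]|/objective_eqP-eqD]; last exact/solution_of/eqD.
apply/objective_eqP => //; apply: le_anti.
by rewrite objective_le //= -/Delta -eqD0 sol_x.
Qed.
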